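(* Let $G$ be a finite abelian group of order $k$ with identity $e$, and let $p:G\to[0,1]$ be the one-step law of a symmetric random walk on $G$, i.e. $\sum_{s\in G}p(s)=1$ and $p(s)=p(s^{-1})$ for all $s\in G$, with $p(e)=0$. Let $\rho_0,\dots,\rho_{k-1}$ be the irreducible characters of $G$. For $n\ge1$ and $g\in G$ let $m_n(g)=P(\tau_{g,e}=n)$ (so that $m_n(e)=0$ and $m_1=p$), let $\widehat{m_n}(\rho)=\sum_{g\in G}m_n(g)\rho(g)$, and let $\widehat{m_n}$ also denote the column vector $(\widehat{m_n}(\rho_0),\dots,\widehat{m_n}(\rho_{k-1}))^{T}$. Let $A$ be the $k\times k$ matrix $$A=\left(I-\tfrac1k J\right)\operatorname{diag}\bigl(\widehat p(\rho_0),\dots,\widehat p(\rho_{k-1})\bigr),$$ where $J$ is the $k\times k$ all-ones matrix and $\widehat p(\rho)=\sum_{s\in G}p(s)\rho(s)$. Then for all $n\ge1$, $$\widehat{m_n}=A^{\,n-1}\,\widehat{m_1}.$$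
   Context: The random walk on $G$ with one-step law $p$ is the Markov chain $(X_t)_{t\ge0}$ that moves from $x$ to $xs$ with probability $p(s)$, for $x,s\in G$. The hitting time is $\tau_{g,e}=\inf\{t\ge0: X_t=e\}$ for the walk started at $X_0=g$. The irreducible characters of $G$ are the homomorphisms $G\to\mathbb{C}^\times$; there are $k=|G|$ of them. *)

(* Defs.v *)
From mathcomp Require Import all_boot all_order all_algebra all_fingroup.
From mathcomp Require Import all_classical all_reals all_analysis.
From mathcomp Require Export complex.

Set Implicit Arguments.
Unset Strict Implicit.
Unset Printing Implicit Defensive.

Import Order.TTheory GRing.Theory Num.Theory.

Local Open Scope classical_set_scope.
Local Open Scope complex_scope.
Local Open Scope ring_scope.

Definition symmetric_step_law (R : realType) (gT : finGroupType)
    (p : gT -> R) : Prop :=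
  [/\ forall s, 0 <= p s <= 1,
      \sum_(s : gT) p s = 1,
      forall s, p s = p (s^-1)%g
    & p 1%g = 0].

Definition cond_prob (R : realType) (d : measure_display)
    (T : measurableType d) (P : probability T R) (A B : set T) : R :=
  fine (P (A `&` B)) / fine (P B).

(* Measurability is with respect to the discrete sigma-algebra on gT. The
   initial condition and the transition probabilities are only imposed almost
   surely, resp. on histories of nonzero probability. *)
Definition is_random_walk (R : realType) (gT : finGroupType) (p : gT -> R)
    (d : measure_display) (T : measurableType d) (P : probability T R)
    (X : nat -> T -> gT) (g : gT) : Prop :=
  [/\ forall t (B : set gT), measurable (X t @^-1` B),
      P [set w | X 0%N w = g] = 1%E
    & forall (t : nat) (x : nat -> gT) (s : gT),
        let history := [set w | forall i, (i <= t)%N -> X i w = x i] in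
        P history != 0%E ->
        cond_prob P [set w | X t.+1 w = (x t * s)%g] history = p s].

(* The value is +oo on trajectories that never visit the identity. *)
Definition hitting_time (R : realType) (gT : finGroupType) (T : Type)
    (X : nat -> T -> gT) (w : T) : \bar R :=
  ereal_inf [set (t%:R)%:E | t in [set t : nat | X t w = 1%g]].

Definition hitting_prob (R : realType) (gT : finGroupType)
    (d : measure_display) (T : measurableType d) (P : probability T R)
    (X : nat -> T -> gT) (n : nat) : R :=
  fine (P [set w | hitting_time R X w = (n%:R)%:E]).

Definition is_character (R : realType) (gT : finGroupType)
    (rho : gT -> R[i]) : Prop :=
  (forall x, rho x != 0) /\ (forall x y, rho (x * y)%g = rho x * rho y).

(* rho lists every character exactly once. *)
Definition characters_enum (R : realType) (gT : finGroupType) (k : nat)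
    (rho : 'I_k -> gT -> R[i]) : Prop :=
  [/\ forall i, is_character (rho i),
      injective rho
    & forall chi : gT -> R[i], is_character chi -> exists i, rho i = chi].

Definition fourier (R : realType) (gT : finGroupType) (f : gT -> R)
    (rho : gT -> R[i]) : R[i] :=
  \sum_(g : gT) (f g)%:C * rho g.

Definition fourier_vec (R : realType) (gT : finGroupType) (k : nat)
    (rho : 'I_k -> gT -> R[i]) (f : gT -> R) : 'cV[R[i]]_k :=
  \col_i fourier f (rho i).

Definition transfer_mx (R : realType) (gT : finGroupType) (k : nat)
    (rho : 'I_k -> gT -> R[i]) (p : gT -> R) : 'M[R[i]]_k :=
  (1%:M - k%:R^-1 *: const_mx 1) *m diag_mx (\row_i fourier p (rho i)).

(* Main.v *)
Require Import Defs.
From mathcomp Require Import all_boot all_order all_algebra all_fingroup.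
From mathcomp Require Import all_classical all_reals all_analysis.

Set Implicit Arguments.
Unset Strict Implicit.
Unset Printing Implicit Defensive.

Import Order.TTheory GRing.Theory Num.Theory.

(** By the Markov property, [m_(n+1)] is the correlation
    [g |-> sum_s p(s) m_n(g s)] with its value at the identity replaced by 0.
    As [p] is symmetric, the Fourier transform turns the correlation into the
    product of the transforms of [p] and [m_n]. By orthogonality of the
    characters, removing the value at the identity subtracts from every entry
    the mean of that product over all characters, which is the multiplication
    by [I - J/k]. *)

(** * Characters and the Fourier transform *)

Section Characters.
Local Open Scope complex_scope.
Local Open Scope ring_scope.
Variables (R : realType) (gT : finGroupType).

Section OneCharacter.
Variables (chi : gT -> R[i]) (chi_char : is_character chi).

Lemma character1 : chi 1%g = 1.
Proof.
case: chi_char => nz chiM; apply: (mulfI (nz 1%g)).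
by rewrite -chiM mulg1 mulr1.
Qed.

(** Translation by [y] permutes the group and multiplies the sum by [chi y], so [1 - chi y]
    annihilates the sum. *)
Lemma sum_character y : chi y != 1 -> \sum_x chi x = 0.
Proof.
case: chi_char => _ chiM chiy.
have /eqP : \sum_x chi x = chi y * \sum_x chi x.
  by rewrite mulr_sumr (reindex_inj (mulgI y)); apply: eq_bigr => x _.
rewrite -subr_eq0 -{1}[\sum_x _]mul1r -mulrBl mulf_eq0 subr_eq0 eq_sym.
by rewrite (negPf chiy) => /eqP.
Qed.

(** Replacing [s] by its inverse leaves [p] unchanged by symmetry and makes the correlation a
    convolution; putting [g = h * s] then splits [chi g] into [chi h * chi s]. *)
Lemma fourier_correlation (p f : gT -> R) : (forall s, p s = p (s^-1)%g) ->
  fourier (fun g => \sum_s p s * f (g * s)%g) chi = fourier p chi * fourier f chi.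
Proof.
move=> psym; case: chi_char => _ chiM; rewrite /fourier.
under eq_bigr do rewrite rmorph_sum mulr_suml.
rewrite exchange_big mulr_suml (reindex_inj invg_inj) /=; apply: eq_bigr => s _.
rewrite -psym mulr_sumr (reindex_inj (mulIg s)) /=; apply: eq_bigr => h _.
by rewrite mulgK chiM rmorphM /= [chi h * _]mulrC mulrACA.
Qed.

End OneCharacter.

(* With as many characters as group elements the table of values is square,
   so that orthogonality of its rows gives that of its columns. *)
Lemma sum_characters (rho : 'I_#|gT| -> gT -> R[i]) (g : gT) :
  characters_enum rho -> \sum_i rho i g = if g == 1%g then #|gT|%:R else 0.
Proof.
case=> rho_char rho_inj _.
have k0 : #|gT|%:R != 0 :> R[i].
  by rewrite pnatr_eq0 -lt0n; apply/card_gt0P; exists 1%g.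
pose M := \matrix_(i < #|gT|, j < #|gT|) rho i (enum_val j).
(* The candidate inverse of [M]: inverses of character values stand where complex conjugates usually
   do. *)
pose N := \matrix_(j < #|gT|, i < #|gT|) (#|gT|%:R^-1 * (rho i (enum_val j))^-1).
have MN : M *m N = 1%:M.
  apply/matrixP => i j; rewrite !mxE.
  under eq_bigr => l _ do rewrite !mxE mulrCA.
  rewrite -mulr_sumr -(big_enum_val (fun x => rho i x * (rho j x)^-1)) /=.
  have [ij|ij] := eqVneq i j.
    rewrite ij; under eq_bigr => x _ do rewrite mulfV ?(rho_char j).1 //.
    by rewrite sumr_const mulVf.
  (* The quotient of two distinct characters is a nontrivial character, so its values sum to 0. *)
  have [y y1] : exists y, rho i y * (rho j y)^-1 != 1.
    apply/existsP; apply: contraNT ij => /existsPn H; apply/eqP.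
    apply: rho_inj; apply/funext => y; have /negPn/eqP e := H y.
    by rewrite -[RHS]mul1r -e divfK ?(rho_char j).1.
  rewrite (@sum_character (fun x => rho i x * (rho j x)^-1) _ y) ?mulr0 //.
  split=> [x|x x']; first by rewrite mulf_neq0 ?invr_eq0 ?(rho_char _).1.
  by rewrite !(rho_char _).2 invfM mulrACA.
(* In the row of the identity, the product [N *m M] has as entries the means of [rho i g] over
   [i]. *)
have /matrixP/(_ (enum_rank 1%g) (enum_rank g)) := mulmx1C MN.
rewrite !mxE; under eq_bigr => i _ do
  rewrite !mxE !enum_rankK (character1 (rho_char i)) invr1 mulr1.
rewrite -mulr_sumr (inj_eq enum_rank_inj) eq_sym => e.
apply: (mulfI (invr_neq0 k0)); rewrite e.
by case: eqP => _; rewrite ?mulVf ?mulr0.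
Qed.

(** The first-step recursion for the hitting law: a walk started at the identity has hitting time 0,
    so every later time gets probability 0 there. *)
Definition kill_step (p f : gT -> R) (g : gT) : R :=
  if g == 1%g then 0 else \sum_s p s * f (g * s)%g.

Lemma fourier_vec_kill_step (rho : 'I_#|gT| -> gT -> R[i]) (p f : gT -> R) :
    characters_enum rho -> (forall s, p s = p (s^-1)%g) ->
  fourier_vec rho (kill_step p f) = transfer_mx rho p *m fourier_vec rho f.
Proof.
move=> rhoE psym; have [rho_char _ _] := rhoE.
have k0 : #|gT|%:R != 0 :> R[i].
  by rewrite pnatr_eq0 -lt0n; apply/card_gt0P; exists 1%g.
pose c g := \sum_s p s * f (g * s)%g.
(* Fourier inversion at the identity: summed over all characters, only the term of [c] at [1%g]
   survives. *)
have meanE : \sum_j fourier p (rho j) * fourier f (rho j) = #|gT|%:R * (c 1%g)%:C.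
  under eq_bigr => j _ do rewrite -fourier_correlation //.
  rewrite exchange_big (bigD1 1%g) //= [X in _ + X]big1 ?addr0.
    by rewrite -mulr_sumr sum_characters // eqxx mulrC.
  by move=> g g1; rewrite -mulr_sumr sum_characters // (negPf g1) mulr0.
apply/colP => i; rewrite /transfer_mx -mulmxA mulmxBl mul1mx -scalemxAl.
rewrite !mul_diag_mx !mxE.
under [X in _ - _ * X]eq_bigr => j _ do rewrite !mxE mul1r.
(* The subtracted mean is [c 1%g], exactly the summand at the identity in the transform of [c]. *)
rewrite meanE mulKf // -fourier_correlation //.
rewrite /fourier (bigD1 1%g) //= [in RHS](bigD1 1%g) //=.
rewrite /kill_step eqxx mul0r add0r (character1 (rho_char i)) mulr1 addrAC subrr add0r.
by apply: eq_bigr => g /negPf ->.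
Qed.

End Characters.

(** * The law of the hitting time *)

Section HittingTime.
Local Open Scope classical_set_scope.
Local Open Scope ring_scope.
Variables (R : realType) (gT : finGroupType).

(** Time is counted from [t] so that, off the identity at time [t], the event for [t] and [n.+1] is
    the one for [t.+1] and [n]. *)
Definition first_visit (T : Type) (X : nat -> T -> gT) (t n : nat) : set T :=
  [set w | X (t + n)%N w = 1%g /\ forall i, (i < n)%N -> X (t + i)%N w != 1%g].

Lemma hitting_time_first_visit (T : Type) (X : nat -> T -> gT) (n : nat) :
  [set w | hitting_time R X w = (n%:R)%:E] = first_visit X 0 n.
Proof.
apply/seteqP; split=> w; rewrite /first_visit /hitting_time /= ?add0n.
  have [[t Xt] | noX] := pselect (exists t, X t w = 1%g).
    have exX : exists t, X t w == 1%g by exists t; apply/eqP.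
    case: (ex_minnP exX) => m /eqP Xm minm.
    have -> : ereal_inf [set (t%:R)%:E | t in [set t | X t w = 1%g]] = (m%:R)%:E :> \bar R.
      apply/eqP; rewrite eq_le; apply/andP; split.
        by apply: ereal_inf_lbound; exists m.
      apply: le_ereal_inf_tmp => _ [t' /= Xt' <-].
      by rewrite lee_fin ler_nat; apply/minm/eqP.
    case=> /eqP; rewrite eqr_nat => /eqP <-; split=> // i im.
    by apply/negP => /minm; rewrite leqNgt im.
  (* Without a visit the infimum is [+oo], which differs from [n]. *)
  have -> : [set t | X t w = 1%g] = set0.
    by apply/seteqP; split=> // t Xt; case: noX; exists t.
  by rewrite image_set0 ereal_inf0.
case=> Xn Xlt; apply/eqP; rewrite eq_le; apply/andP; split.
  by apply: ereal_inf_lbound; exists n.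
apply: le_ereal_inf_tmp => _ [t /= Xt <-].
rewrite lee_fin ler_nat leqNgt; apply/negP => /Xlt.
by rewrite Xt eqxx.
Qed.

Definition first_visit_prob (p : gT -> R) (n : nat) : gT -> R :=
  iter n (kill_step p) (fun g => (g == 1%g)%:R).

Lemma total_probability (I : finType) (d : measure_display)
    (T : measurableType d) (P : probability T R) (Y : T -> I) (A : set T) :
    measurable A -> (forall i, measurable (Y @^-1` [set i])) ->
  P A = (\sum_i P (A `&` Y @^-1` [set i]))%E.
Proof.
move=> mA mY.
have {1}-> : A = \bigcup_(i in [set` index_enum I]) (A `&` Y @^-1` [set i]).
  apply/seteqP; split=> [w Aw|w [i _ []//]].
  by exists (Y w) => //=; rewrite mem_index_enum.
rewrite measure_fin_bigcup //.
- by rewrite -fsbig_seq ?index_enum_uniq.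
- by move=> i j _ _ [w [[_ <-] [_ <-]]].
- by move=> i _; exact: measurableI.
Qed.

Section Walk.
Variables (p : gT -> R) (d : measure_display) (T : measurableType d).
Variables (P : probability T R) (X : nat -> T -> gT) (g : gT).
Hypothesis X_walk : is_random_walk p P X g.

Definition history (x : nat -> gT) (t : nat) : set T :=
  [set w | forall i, (i <= t)%N -> X i w = x i].

Lemma measurable_history x t : measurable (history x t).
Proof.
case: X_walk => mX _ _.
have -> : history x t = \bigcap_(i in [set i | (i <= t)%N]) (X i @^-1` [set x i]).
  by apply/seteqP; split.
by apply: bigcap_measurable => [|i _]; [exists 0%N | exact: mX].
Qed.

Lemma measurable_first_visit t n : measurable (first_visit X t n).
Proof.
case: X_walk => mX _ _.
have -> : first_visit X t n = X (t + n)%N @^-1` [set 1%g] `&`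
    \bigcap_(i in [set i | (i < n)%N]) (X (t + i)%N @^-1` [set~ 1%g]).
  by apply/seteqP; split=> w [Xn Xlt]; split=> // i ilt; apply/eqP; exact: Xlt.
apply: measurableI; first exact: mX.
have [->|n0] := posnP n.
  by rewrite (_ : [set _ | _] = set0) ?bigcap_set0 //; apply/seteqP; split.
by apply: bigcap_measurable => [|i _]; [exists 0%N | exact: mX].
Qed.

Definition extend (x : nat -> gT) (t : nat) (s : gT) (i : nat) : gT :=
  if i == t.+1 then (x t * s)%g else x i.

Lemma history_extend x t s :
  history (extend x t s) t.+1 =
    [set w | X t.+1 w = (x t * s)%g] `&` history x t.
Proof.
apply/seteqP; split=> [w H|w [Xt H] i].
  split=> [|i it]; first by rewrite /= H // /extend eqxx.
  by rewrite H ?leqW // /extend ltn_eqF.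
by rewrite /extend leq_eqVlt ltnS; case: eqP => [-> _|_ /=]; last exact: H.
Qed.

Lemma prob_history_extend x t s :
  P (history (extend x t s) t.+1) = ((p s)%:E * P (history x t))%E.
Proof.
case: X_walk => mX _ step.
have mH := measurable_history x t.
have mE := measurable_history (extend x t s) t.+1.
(* The transition law says nothing about a null history, but its extensions are then null by
   monotonicity. *)
have [H0|H0] := eqVneq (P (history x t)) 0%E.
  rewrite H0 mule0; apply: (subset_measure0 mE mH) => //.
  by rewrite history_extend; exact: subIsetr.
have := step t x s H0; rewrite /cond_prob -/(history x t) -history_extend => <-.
have fH := fin_num_measure P _ mH; have fE := fin_num_measure P _ mE.
rewrite -[P (history x t) in RHS]fineK // -EFinM divfK ?fineK //.
by rewrite fine_eq0.
Qed.

(* Only [t = 0] is used, but the induction on [n] needs arbitrary histories. *)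
Lemma prob_history_first_visit n x t :
  P (history x t `&` first_visit X t n) =
    (P (history x t) * (first_visit_prob p n (x t))%:E)%E.
Proof.
case: (X_walk) => mX _ _.
elim: n x t => [|n IHn] x t.
  rewrite /first_visit_prob /=; case: eqP => xt.
    rewrite mule1; congr (P _); apply/seteqP; split=> [w []//|w H].
    by split=> //; split=> //=; rewrite addn0 H.
  rewrite mule0 (_ : _ `&` _ = set0) ?measure0 //.
  apply/seteqP; split=> // w [H [+ _]]; rewrite addn0 H // => /xt //.
rewrite /first_visit_prob iterS -/(first_visit_prob p n) /kill_step.
have [xt|xt] := eqVneq (x t) 1%g.
  rewrite mule0 (_ : _ `&` _ = set0) ?measure0 //.
  apply/seteqP; split=> // w [H [_ /(_ 0%N isT)]].
  by rewrite addn0 H // xt eqxx.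
(* Split by the increment [s] of the next step; each piece is an extended history followed by a
   first visit counted from [t.+1]. *)
rewrite (total_probability P (Y := fun w => ((x t)^-1 * X t.+1 w)%g)); first last.
- move=> s; rewrite (_ : _ @^-1` _ = X t.+1 @^-1` [set (x t * s)%g]); first exact: mX.
  by apply/seteqP; split=> w /= => [<-|->]; rewrite ?mulKVg ?mulKg.
- by apply: measurableI; [exact: measurable_history|exact: measurable_first_visit].
have mH := measurable_history x t.
rewrite -sumEFin -[P (history x t)]fineK ?fin_num_measure //.
rewrite sumEFin -EFinM mulr_sumr -sumEFin; apply: eq_bigr => s _.
rewrite mulrA EFinM [_ * p s]mulrC EFinM fineK ?fin_num_measure //.
rewrite -prob_history_extend.
have -> : (x t * s)%g = extend x t s t.+1 by rewrite /extend eqxx.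
rewrite -IHn history_extend; congr (P _); apply/seteqP; split=> w /=.
  move=> [[H [Xn Xlt]] <-]; rewrite mulKVg; split=> //; split.
    by rewrite addSnnS.
  by move=> i ilt; rewrite addSnnS Xlt.
move=> [[Xt H] [Xn Xlt]]; rewrite Xt mulKg; split=> //; split=> //.
split; first by rewrite -addSnnS.
case=> [_|i ilt]; first by rewrite addn0 H.
by rewrite -addSnnS Xlt.
Qed.

Lemma hitting_probE n : hitting_prob P X n = first_visit_prob p n g.
Proof.
case: (X_walk) => mX X0 _; rewrite /hitting_prob hitting_time_first_visit.
pose x := fun _ : nat => g.
have hE : history x 0 = [set w | X 0%N w = g].
  by apply/seteqP; split=> [w H|w Xw [|i]//]; exact: (H 0%N).
have mH := measurable_history x 0.
have mV := measurable_first_visit 0 n.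
(* The walk starts at [g] only almost surely, so the paths starting elsewhere are discarded as a
   null set. *)
have nullC : P (~` history x 0) = 0%E.
  by rewrite probability_setC // hE X0 subee.
suff -> : P (first_visit X 0 n) = P (history x 0 `&` first_visit X 0 n).
  by rewrite prob_history_first_visit hE X0 mul1e.
rewrite -{1}(setUIDK (first_visit X 0 n) (history x 0)).
rewrite measureU0 1?setIC //; first exact: measurableI.
  by apply: measurableD.
apply: (subset_measure0 _ _ _ nullC).
- exact: measurableD.
- exact: measurableC.
- by move=> w [].
Qed.

End Walk.
End HittingTime.

Local Open Scope ring_scope.

Theorem mainTheorem4 (R : realType) (gT : finGroupType) (k : nat)
    (G_abelian : abelian [set: gT]) (G_order : #|gT| = k)
    (p : gT -> R) (p_law : symmetric_step_law p)
    (rho : 'I_k -> gT -> R[i]) (rho_enum : characters_enum rho)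
    (d : gT -> measure_display) (T : forall g : gT, measurableType (d g))
    (P : forall g : gT, probability (T g) R)
    (X : forall g : gT, nat -> T g -> gT)
    (X_walk : forall g : gT, is_random_walk p (P g) (X g) g)
    (n : nat) (n_ge1 : (1 <= n)%N) :
  let m (j : nat) (g : gT) : R := hitting_prob (P g) (X g) j in
  fourier_vec rho (m n) =
    transfer_mx rho p ^+ (n - 1) *m fourier_vec rho (m 1%N).
Proof.
move=> m; case: k / G_order rho rho_enum => rho rho_enum.
have mE j : m j = first_visit_prob p j.
  by apply/funext => g; exact: hitting_probE.
have [_ _ psym _] := p_law.
case: n n_ge1 => // n _; rewrite subn1 /= !mE.
elim: n => [|n IHn]; first by rewrite expr0 mul1mx.
(* One more time step applies [kill_step] once, hence multiplies by the matrix once on the left. *)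
rewrite [first_visit_prob p n.+2]iterS fourier_vec_kill_step //.
by rewrite -/(first_visit_prob p n.+1) IHn mulmxA exprS.
Qed.
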